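(* Let $k\geq 2$ be an integer and let $G$ be a $1$-tough and $k$-connected $(P_2\cup kP_1)$-free graph. If $\alpha_e(G)\leq k$, then $G$ is hamiltonian.
   Context: All graphs are finite and simple. $\omega(G)$ denotes the number of components of $G$ and $dist_G(x,y)$ the length of a shortest path between $x$ and $y$ in $G$. For a real $t\geq 0$, $G$ is $t$-tough if $|S|\geq t\cdot\omega(G-S)$ for every vertex cut $S\subseteq V(G)$ (i.e. every $S$ such that $G-S$ is disconnected). A graph is hamiltonian if it contains a Hamiltonian cycle, i.e. a cycle containing every vertex. $P_2\cup kP_1$ is the graph consisting of one edge and $k$ isolated vertices; $G$ is $H$-free if no induced subgraph of $G$ is isomorphic to $H$. For an integer $k$, a set $S\subseteq V(G)$ is a $k$-essential independent set of $G$ with center $x$ if $S$ is an independent set of $G$ with $|S|=k$, $x\in S$, and $dist_G(x,v)=2$ for all $v\in S\setminus\{x\}$. The essential independence number $\alpha_e(G)$ is the maximum integer $k$ such that $G$ contains a $k$-essential independent set (with some center). *)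

(* Defs.v *)
From mathcomp Require Import all_boot all_order all_algebra.
From mathcomp Require Import reals.

Set Implicit Arguments.
Unset Strict Implicit.
Unset Printing Implicit Defensive.

Import Order.TTheory GRing.Theory Num.Theory.

(* A finite simple graph is a symmetric irreflexive relation on a finType;
   both properties are hypotheses of the theorem rather than of the
   definitions below. *)
Section Graphs.

Variables (T : finType) (e : rel T).

(* G[A], kept on the vertex type T: vertices outside A become isolated. *)
Definition induced (A : {set T}) : rel T := [rel x y in A | e x y].

(* omega(G - S); only the components meeting ~: S are counted, so the
   isolated vertices of S do not contribute. *)
Definition omega_del (S : {set T}) : nat := n_comp (induced (~: S)) (~: S).

Definition connected_del (S : {set T}) : Prop :=
  forall x y : T, x \notin S -> y \notin S -> connect (induced (~: S)) x y.

Definition vertex_cut (S : {set T}) : Prop := ~ connected_del S.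

Definition tough (R : realType) (t : R) : Prop :=
  forall S : {set T}, vertex_cut S ->
    (t * (omega_del S)%:R <= #|S|%:R)%R.

Definition k_connected (k : nat) : Prop :=
  k < #|T| /\ forall S : {set T}, #|S| < k -> connected_del S.

Definition hamiltonian : Prop :=
  exists c : seq T, [/\ 2 < size c, ucycle e c & forall x : T, x \in c].

Definition path_of_length (x y : T) (d : nat) : bool :=
  [exists p : d.-tuple T, [&& path e x p, last x p == y & uniq (x :: p)]].

(* None stands for an infinite distance; a path has fewer than #|T| edges. *)
Definition dist (x y : T) : option nat :=
  ohead [seq d <- iota 0 #|T| | path_of_length x y d].

Definition independent (S : {set T}) : bool :=
  [forall x in S, forall y in S, ~~ e x y].

Definition essential_independent (k : nat) (S : {set T}) (x : T) : bool :=
  [&& independent S, #|S| == k, x \in S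
    & [forall v in S :\ x, dist x v == Some 2]].

Definition alpha_e : nat :=
  \max_(k < #|T|.+1 |
        [exists S : {set T}, exists x : T, essential_independent k S x]) k.

End Graphs.

Definition free_of (U T : finType) (h : rel U) (e : rel T) : Prop :=
  ~ exists f : U -> T, injective f /\ forall a b : U, e (f a) (f b) = h a b.

(* P_2 \cup kP_1: the two ends of the edge are the vertices inl _. *)
Definition P2_kP1 (k : nat) : rel ('I_2 + 'I_k)%type :=
  fun u v => match u, v with
             | inl i, inl j => i != j
             | _, _ => false
             end.

(* Main.v *)
Require Import Defs.
From mathcomp Require Import all_boot all_order all_algebra.
From mathcomp Require Import reals.

(** The argument is the one of Chvatal and Erdos.  Let [c] be a longest cycle,
    suppose that it misses a vertex [v], and let [H] be the component of [v]
    outside [c].  Call attachments the vertices of [c] that have a neighbour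
    in [H].  The successor along [c] of an attachment is never an attachment,
    and the successors of two attachments are never adjacent: otherwise [c]
    could be rerouted through [H] into a longer cycle ([cycle_insert],
    [cycle_crossover]).  In particular the attachments do not exhaust [c], so
    they separate [H] from some vertex of [c], and by connectivity there are at
    least [k] of them ([boundary_card]).

    If [H] contains an edge, that edge together with [k] of the successors
    induces a copy of [P_2 \cup kP_1] ([component_edge_P2_kP1]).  If not, all
    neighbours of [v] lie on [c], and there are at least [k] of them; their
    successors are at distance exactly 2 from [v], so together with [v] they
    form an essential independent set with at least [k + 1] elements, centred
    at [v] ([successors_essential]).  Both outcomes are excluded by hypothesis,
    so [c] is a Hamiltonian cycle. *)

Set Implicit Arguments.
Unset Strict Implicit.
Unset Printing Implicit Defensive.

(** * Rerouting a cycle *)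

Section Rerouting.

Variables (T : finType) (e : rel T).
Hypothesis e_sym : symmetric e.

Lemma next_head (c : seq T) (x : T) : next (x :: c) x = head x c.
Proof. by case: c => [|y c] /=; rewrite eqxx. Qed.

(** When [c2] is empty the successor wraps around to [x], hence the default value
    of [head]. *)
Lemma next_split (c1 c2 : seq T) (x y : T) :
  uniq (x :: c1 ++ y :: c2) -> next (x :: c1 ++ y :: c2) y = head x c2.
Proof.
move=> Uc; have yc : y \in x :: c1 ++ y :: c2.
  by rewrite inE mem_cat mem_head !orbT.
rewrite next_nth yc.
have -> : index y (x :: c1 ++ y :: c2) = (size c1).+1.
  move: Uc; rewrite -!cat_cons cat_uniq => /and3P[_ /norP[yc1 _] _].
  by rewrite index_cat (negPf yc1) /= eqxx addn0.
by rewrite nth_cat ltnNge leqnSn subSnn /= nth0.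
Qed.

Lemma ucycle_extend (c p c' : seq T) :
    p != [::] -> uniq (c ++ p) -> perm_eq c' (c ++ p) -> cycle e c' ->
  exists c', ucycle e c' /\ size c < size c'.
Proof.
move=> p0 Ucp Pc' Cc'; exists c'; split.
  by rewrite /ucycle Cc' (perm_uniq Pc').
by rewrite (perm_size Pc') size_cat -[ltnLHS]addn0 ltn_add2l lt0n size_eq0.
Qed.

(** The detour [p] replaces the edge from [x] to its successor. *)
Lemma cycle_insert (c p : seq T) (x : T) :
    ucycle e c -> x \in c -> p != [::] -> uniq (c ++ p) ->
    path e x (rcons p (next c x)) ->
  exists c', ucycle e c' /\ size c < size c'.
Proof.
move=> /andP[Cc Uc] xc p0 Ucp; have [i s def_c] := rot_to xc.
rewrite -(next_rot i Uc) def_c next_head => Pp.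
have Ps : path e x (rcons s x) by rewrite -(rot_cycle i) def_c in Cc.
have Pc : perm_eq c (x :: s) by rewrite -def_c perm_sym perm_rot.
apply: (@ucycle_extend c p (x :: p ++ s)) => //.
  by rewrite perm_sym (perm_catr p Pc) /= perm_cons perm_catC.
rewrite /= rcons_cat; case: s Ps Pp {def_c Pc} => [|a s] /=.
  by rewrite cats1.
by move=> /andP[_ Ps]; rewrite rcons_path cat_path /= Ps => /andP[-> ->].
Qed.

(** If the successors of [x] and [y] are adjacent, the two segments into which
    [x] and [y] cut the cycle can be glued along that edge and the detour, one
    of them being traversed backwards. *)
Lemma cycle_crossover (c p : seq T) (x y : T) :
    ucycle e c -> x \in c -> y \in c -> x != y -> p != [::] ->
    uniq (c ++ p) -> path e x (rcons p y) -> e (next c x) (next c y) ->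
  exists c', ucycle e c' /\ size c < size c'.
Proof.
move=> /andP[Cc Uc] xc yc neq_xy p0 Ucp Pp; have [i s def_c] := rot_to xc.
rewrite -!(next_rot i Uc) def_c.
have Ps : path e x (rcons s x) by rewrite -(rot_cycle i) def_c in Cc.
have Pc : perm_eq c (x :: s) by rewrite -def_c perm_sym perm_rot.
have Us : uniq (x :: s) by rewrite -(perm_uniq Pc).
have ys : y \in s by move: yc; rewrite (perm_mem Pc) inE eq_sym (negPf neq_xy).
case/splitPr: s / ys {def_c} Ps Pc Us => s1 s2 Ps Pc Us.
rewrite next_split // next_head => exy.
(* The new cycle takes the detour from [x] to [y], goes back along [c] to the
   successor of [x], jumps to the successor of [y] and follows [c] to [x]. *)
apply: (@ucycle_extend c p (x :: p ++ rev (rcons s1 y) ++ s2)) => //.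
  rewrite perm_sym (perm_catr p Pc) /= perm_cons perm_catC perm_cat2l.
  by rewrite -cat_rcons perm_cat2r perm_sym perm_rev.
move: Pp Ps exy; rewrite rev_rcons /= rcons_cat /= rcons_path.
rewrite rcons_cat !cat_path /= => /andP[Pp epy] /and3P[Ps1 e1 Ps2] exy.
rewrite Pp epy rcons_cat cat_path /=.
case: s1 Ps1 e1 exy {Us Pc} => [|a s1] /=.
  by case: s2 Ps2 => [|b s2] /= => [_ _ _ ->|/andP[_ ->] _ _ ->].
move=> /andP[_ Ps1] e1; rewrite rev_cons last_rcons => exy.
rewrite -rev_cons -(belast_rcons a s1 y) -[y in path _ y _](last_rcons a s1 y).
rewrite rev_path (eq_path (e' := e)) => [|u v]; last exact: e_sym.
rewrite (rcons_path e a s1 y) Ps1 e1 /=.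
by case: s2 Ps2 exy => [|b s2] /= => [_ ->|/andP[_ ->] ->].
Qed.

End Rerouting.

(** * Components, attachments and connectivity *)

Section Attachments.

Variables (T : finType) (e : rel T).
Hypothesis e_sym : symmetric e.

Definition component (A : {set T}) (v : T) : {set T} :=
  [set w | connect (induced e A) v w].

(** The outer vertex boundary; for a component of the complement of a cycle it
    consists of the attachments. *)
Definition boundary (H : {set T}) : {set T} :=
  [set y | (y \notin H) && [exists x in H, e x y]].

Lemma connect_closed (r : rel T) (H : {set T}) (x y : T) :
    (forall u v, r u v -> u \in H -> v \in H) ->
  connect r x y -> x \in H -> y \in H.
Proof.
move=> closedH /connectP[p + ->]; elim: p x => //= z p IHp x /andP[xz Pp] xH.
exact: IHp Pp (closedH _ _ xz xH).
Qed.

Lemma connect_induced_path (A : {set T}) (x y : T) :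
    x \in A -> connect (induced e A) x y ->
  exists p, [/\ path e x p, last x p = y, uniq (x :: p) & all (mem A) (x :: p)].
Proof.
move=> xA /connectP[p0 Pp0 ->]; case/shortenP: Pp0 => p Pp Up _.
exists p; split=> //; first by apply: sub_path Pp => u v /andP[].
rewrite /= xA /=; elim: p x {Up xA} Pp => //= z p IHp x.
by case/andP=> /andP[/andP[_ ->] _] /IHp.
Qed.

Lemma induced_sym (A : {set T}) : connect_sym (induced e A).
Proof.
by apply: sym_connect_sym => u v;
  rewrite /induced /= e_sym [(u \in A) && _]andbC.
Qed.

Lemma component_sub (A : {set T}) (v : T) : v \in A -> component A v \subset A.
Proof.
move=> vA; apply/subsetP => w; rewrite inE => vw.
by apply: connect_closed vw vA => a b /andP[/andP[_ ->]].
Qed.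

Lemma component_closed (A : {set T}) (v x y : T) :
  v \in A -> x \in component A v -> y \in A -> e x y -> y \in component A v.
Proof.
move=> vA xH yA xy; have xA := subsetP (component_sub vA) x xH.
rewrite inE in xH; rewrite inE; apply: connect_trans xH (connect1 _).
by rewrite /induced /= xA yA.
Qed.

Lemma boundary_component (A : {set T}) (v : T) :
  v \in A -> boundary (component A v) \subset ~: A.
Proof.
move=> vA; apply/subsetP => y; rewrite !inE => /andP[yH /exists_inP[x xH xy]].
by apply: contra yH => yA; have := component_closed vA xH yA xy; rewrite inE.
Qed.

(** Every path that leaves [H] passes through its boundary, so the boundary
    cuts [x] from [z]. *)
Lemma boundary_card (k : nat) (H : {set T}) (x z : T) :
    k_connected e k -> x \in H -> z \notin H -> z \notin boundary H ->
  k <= #|boundary H|.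
Proof.
move=> [_ conn] xH zH zB; rewrite leqNgt; apply/negP => /conn-/(_ x z).
have xB : x \notin boundary H by rewrite inE xH.
move=> /(_ xB zB) xz; case/negP: zH; apply: connect_closed xz xH => u v /=.
case/andP=> /andP[_ +] uv uH; rewrite !inE negb_and negbK => /orP[//|].
by case/negP; apply/exists_inP; exists u.
Qed.

(** The neighbourhood of [x] is the boundary of [[set x]]; if it had fewer than
    [k] elements, some vertex [z] would be left for it to cut off from [x]. *)
Lemma degree_ge (k : nat) (x : T) :
  irreflexive e -> k_connected e k -> k <= #|[set y | e x y]|.
Proof.
move=> e_irr conn; rewrite leqNgt; apply/negP => lt_k.
have xD : x \notin [set y | e x y] by rewrite inE e_irr.
have [z] : exists z, z \notin x |: [set y | e x y].
  apply/existsP; rewrite -negb_forall; apply/negP => /forallP all_in.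
  have: #|T| <= k.
    have := cardsU1 x [set y | e x y]; rewrite xD add1n => cardU.
    apply: leq_trans lt_k; rewrite -cardU -cardsT.
    by apply/subset_leq_card/subsetP => z _; apply: all_in.
  by rewrite leqNgt conn.1.
rewrite !inE negb_or => /andP[zx xz].
have DB : boundary [set x] = [set y | e x y].
  apply/setP => y; rewrite !inE; apply/andP/idP => [[_ /exists_inP[u]]|xy].
    by rewrite inE => /eqP->.
  split; first by apply: contraTneq xy => ->; rewrite e_irr.
  by apply/exists_inP; exists x; rewrite ?inE.
have := @boundary_card k [set x] x z conn; rewrite DB leqNgt lt_k.
by rewrite !inE eqxx zx xz => /(_ isT isT isT).
Qed.

(** Two neighbours of a vertex are joined by a path that avoids it. *)
Lemma exists_cycle (k : nat) :
    irreflexive e -> 2 <= k -> k_connected e k ->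
  exists c, ucycle e c /\ 2 < size c.
Proof.
move=> e_irr hk conn.
have /card_gt0P[x _] : 0 < #|T| by apply: leq_ltn_trans conn.1.
have /card_gt1P[a [b [+ + ab]]] := leq_trans hk (degree_ge x e_irr conn).
rewrite !inE => xa xb.
have neq y : e x y -> y != x by apply: contraTneq => ->; rewrite e_irr.
have ab_conn : connect (induced e (~: [set x])) a b.
  by apply: (conn.2 [set x]); rewrite ?cards1 ?inE ?neq.
have aA : a \in ~: [set x] by rewrite !inE neq.
have [p [Pp lp Up Ap]] := connect_induced_path aA ab_conn.
exists (x :: a :: p); split.
  apply/andP; split; first by rewrite /= xa rcons_path Pp lp e_sym.
  rewrite cons_uniq Up andbT; apply/negP => /(allP Ap) /=.
  by rewrite !inE eqxx.
by case: p lp {Pp Up Ap} => //= eq_ab; rewrite eq_ab eqxx in ab.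
Qed.

Lemma exists_longest_cycle (k : nat) :
    irreflexive e -> 2 <= k -> k_connected e k ->
  exists c, [/\ ucycle e c, 2 < size c &
              forall c', ucycle e c' -> size c' <= size c].
Proof.
move=> e_irr hk conn; have [c0 [Cc0 c0_gt2]] := exists_cycle e_irr hk conn.
pose P n := [exists t : n.-tuple T, ucycleb e t].
have exP : exists n, P n.
  by exists (size c0); apply/existsP; exists (in_tuple c0).
have maxP n : P n -> n <= #|T|.
  case/existsP=> t /andP[_ /card_uniqP].
  by rewrite size_tuple => <-; apply: max_card.
case: (ex_maxnP exP maxP) => n /existsP[t Ct] max_n.
have max_t c' : ucycle e c' -> size c' <= n.
  by move=> Cc'; apply: max_n; apply/existsP; exists (in_tuple c').
by exists t; rewrite size_tuple; split=> //; apply: leq_trans (max_t _ Cc0).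
Qed.

End Attachments.

(** * Successors of the attachments on a longest cycle *)

Section LongestCycle.

Variables (T : finType) (e : rel T) (c : seq T) (v : T).
Hypotheses (e_sym : symmetric e) (e_irr : irreflexive e).
Hypotheses (Cc : ucycle e c) (vc : v \notin c).
Hypothesis c_max : forall c', ucycle e c' -> size c' <= size c.

Let H := component e (~: [set z in c]) v.
Let N := boundary e H.

Let vA : v \in ~: [set z in c]. Proof. by rewrite !inE. Qed.

Lemma self_in_component : v \in H. Proof. by rewrite inE. Qed.

Lemma component_off_cycle u : u \in H -> u \notin c.
Proof. by move/(subsetP (component_sub e vA)); rewrite !inE. Qed.

Lemma attachment_on_cycle x : x \in N -> x \in c.
Proof. by move/(subsetP (boundary_component e vA)); rewrite !inE negbK. Qed.

(** The inner vertices of the detour lie in [H], hence off the cycle. *)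
Lemma attachment_detour x y : x \in N -> y \in N ->
  exists p, [/\ p != [::], uniq (c ++ p) & path e x (rcons p y)].
Proof.
rewrite !inE => /andP[_ /exists_inP[a aH ax]] /andP[_ /exists_inP[b bH yb]].
have aA := subsetP (component_sub e vA) a aH.
have ab : connect (induced e (~: [set z in c])) a b.
  rewrite !inE in aH bH; rewrite induced_sym // in aH.
  exact: connect_trans aH bH.
have [p [Pp lp Up Ap]] := connect_induced_path aA ab.
exists (a :: p); split=> //; last by rewrite /= e_sym ax rcons_path Pp lp.
case/andP: Cc => _ Uc; rewrite cat_uniq Uc Up andbT.
by apply/hasPn => z /(allP Ap); rewrite !inE.
Qed.

Lemma no_longer_cycle : ~ exists c', ucycle e c' /\ size c < size c'.
Proof. by case=> c' [/c_max]; rewrite leqNgt => /negP. Qed.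

Lemma successor_not_attachment x : x \in N -> next c x \notin N.
Proof.
move=> xN; apply/negP => x'N; have [p [p0 Ucp Pp]] := attachment_detour xN x'N.
exact: no_longer_cycle (cycle_insert Cc (attachment_on_cycle xN) p0 Ucp Pp).
Qed.

Lemma successors_independent x y :
  x \in N -> y \in N -> ~~ e (next c x) (next c y).
Proof.
move=> xN yN; have [->|neq_xy] := eqVneq x y; first by rewrite e_irr.
apply/negP => exy; have [p [p0 Ucp Pp]] := attachment_detour xN yN.
have [xc yc] := (attachment_on_cycle xN, attachment_on_cycle yN).
exact: no_longer_cycle (cycle_crossover e_sym Cc xc yc neq_xy p0 Ucp Pp exy).
Qed.

Lemma successor_on_cycle x : x \in N -> next c x \in c.
Proof. by move=> xN; rewrite mem_next attachment_on_cycle. Qed.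

Lemma successor_component_nonadjacent x u :
  x \in N -> u \in H -> ~~ e u (next c x).
Proof.
move=> xN uH; apply: contra (successor_not_attachment xN) => ux.
rewrite inE; apply/andP; split; last by apply/exists_inP; exists u.
by apply: contraL (successor_on_cycle xN) => /component_off_cycle.
Qed.

(** The successor of an attachment provides a vertex of [c] that is no
    attachment, from which the attachments separate [H]. *)
Lemma card_attachments k : 0 < size c -> k_connected e k -> k <= #|N|.
Proof.
move=> c_gt0 conn.
have [z zc zN] : exists2 z, z \in c & z \notin N.
  have [x xc] : exists x, x \in c.
    by case: (c) c_gt0 => // x s _; exists x; apply: mem_head.
  have [xN|] := boolP (x \in N); last by exists x.
  by exists (next c x); rewrite ?successor_on_cycle ?successor_not_attachment.
apply: (boundary_card conn self_in_component _ zN).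
by apply: contraL zc => /component_off_cycle.
Qed.

Lemma next_inj : injective (next c).
Proof. by case/andP: Cc => _ Uc; apply: can_inj (prev_next Uc). Qed.

(** The forbidden subgraph: its edge is the edge of the component, its isolated
    vertices are [k] successors of attachments, which see neither each other
    nor the component. *)
Lemma component_edge_P2_kP1 k u w :
    k <= #|N| -> u \in H -> w \in H -> e u w ->
  ~ free_of (@P2_kP1 k) e.
Proof.
move=> kN uH wH uw; case.
have kS : k <= #|next c @: N| by rewrite card_imset //; apply: next_inj.
pose g (j : 'I_k) := enum_val (widen_ord kS j).
have gS j : exists2 x, x \in N & g j = next c x.
  by apply/imsetP; apply: enum_valP.
have g_inj : injective g by move=> i j /enum_val_inj/(congr1 val)/= /val_inj.
pose h (i : 'I_2) := if i == ord0 then u else w.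
have hH i : h i \in H by rewrite /h; case: ifP.
have gH j : g j \notin H.
  have [x xN ->] := gS j.
  by apply: contraL (successor_on_cycle xN) => /component_off_cycle.
have ehg i j : e (h i) (g j) = false.
  by have [x xN ->] := gS j; apply/negbTE/successor_component_nonadjacent.
have ehh i j : e (h i) (h j) = (i != j).
  by case: i j => [[|[|//]] ?] [[|[|//]] ?];
    rewrite /h -!val_eqE /= ?e_irr // e_sym.
exists (fun a => match a with inl i => h i | inr j => g j end); split.
  move=> [i|i] [j|j] => [eq_h|eq_hg|eq_gh|/g_inj->//].
  - by have := ehh i j; rewrite eq_h e_irr; case: eqP => // ->.
  - by have := gH j; rewrite -eq_hg hH.
  - by have := gH i; rewrite eq_gh hH.
move=> [i|i] [j|j] //=; first by rewrite e_sym.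
have [[x xN ->] [y yN ->]] := (gS i, gS j).
exact/negbTE/successors_independent.
Qed.

End LongestCycle.

(** * Essential independent sets *)

Lemma dist2 (T : finType) (e : rel T) (x a y : T) :
    irreflexive e -> x != y -> ~~ e x y -> e x a -> e a y ->
  dist e x y = Some 2.
Proof.
move=> e_irr xy nexy xa ay.
have neq z t : e z t -> z != t by apply: contraTneq => ->; rewrite e_irr.
have Uxay : uniq [:: x; a; y] by rewrite /= !inE negb_or xy !neq.
have T_gt2 : 2 < #|T|.
  by have := max_card (mem [:: x; a; y]); rewrite (card_uniqP Uxay).
(* Exposing [#|T|] as [3 + m] makes the lengths 0, 1 and 2 computable. *)
rewrite /dist -(subnKC T_gt2) iotaD /=.
have -> : path_of_length e x y 0 = false.
  by apply/existsP => -[p]; rewrite (tuple0 p) /= (negPf xy).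
have -> : path_of_length e x y 1 = false.
  apply/existsP => -[p]; case/tupleP: p => z p; rewrite (tuple0 p) /= andbT.
  by case/andP=> xz /andP[/eqP zy]; rewrite zy (negPf nexy) in xz.
have -> // : path_of_length e x y 2.
by apply/existsP; exists [tuple a; y]; rewrite [path _ _ _]/= xa ay eqxx Uxay.
Qed.

Lemma essential_le_alpha (T : finType) (e : rel T) (S : {set T}) (x : T) :
  essential_independent e #|S| S x -> #|S| <= alpha_e e.
Proof.
move=> essS; have S_lt : #|S| < #|T|.+1 by rewrite ltnS max_card.
apply: (bigmax_sup (Ordinal S_lt)) => //.
by apply/existsP; exists S; apply/existsP; exists x.
Qed.

(** Each neighbour [y] of [v] is an attachment, so [v] is not adjacent to the
    successor of [y] but reaches it through [y].  These successors and [v]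
    itself, as the centre, form the essential independent set. *)
Lemma successors_essential (T : finType) (e : rel T) (c : seq T) (v : T) :
    symmetric e -> irreflexive e -> ucycle e c -> v \notin c ->
    (forall c', ucycle e c' -> size c' <= size c) ->
    (forall y, e v y -> y \in c) ->
  #|[set y | e v y]| < alpha_e e.
Proof.
move=> e_sym e_irr Cc vc c_max Dc; set D := [set y | e v y].
have vH := self_in_component e c v.
have DN y : y \in D -> y \in boundary e (component e (~: [set z in c]) v).
  rewrite inE => vy; rewrite inE; apply/andP; split.
    by apply: contraL (Dc y vy) => /(component_off_cycle vc).
  by apply/exists_inP; exists v.
pose S := v |: next c @: D.
have D'c y : y \in D -> next c y \in c by move/DN/(successor_on_cycle vc).
have vD' : v \notin next c @: D.
  by apply: contra vc => /imsetP[y yD ->]; apply: D'c.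
have cardS : #|S| = #|D|.+1.
  by rewrite cardsU1 vD' card_imset //; apply: next_inj Cc.
have vS' y : y \in D -> ~~ e v (next c y).
  by move/DN => yN; apply: (successor_component_nonadjacent e_sym Cc vc c_max).
rewrite -cardS; apply: (essential_le_alpha (x := v)).
rewrite /essential_independent eqxx setU11 /=; apply/andP; split.
  apply/forall_inP => a /setU1P[->|/imsetP[x xD ->]]; apply/forall_inP => b.
    by case/setU1P=> [->|/imsetP[y yD ->]]; rewrite ?e_irr ?vS'.
  case/setU1P=> [->|/imsetP[y yD ->]]; first by rewrite e_sym vS'.
  exact: (successors_independent e_sym e_irr Cc vc c_max (DN x xD) (DN y yD)).
apply/forall_inP => b /setD1P[bv /setU1P[/eqP|/imsetP[y yD def_b]]].
  by rewrite (negPf bv).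
apply/eqP; apply: (@dist2 _ e v y b) => //; rewrite ?def_b ?vS' //.
- by rewrite -def_b eq_sym.
- by rewrite inE in yD.
- by case/andP: Cc => Cc _; apply: next_cycle Cc (Dc y _); rewrite inE in yD.
Qed.

Theorem corollary1p2 (R : realType) (k : nat) (hk : 2 <= k)
    (T : finType) (e : rel T) (e_sym : symmetric e) (e_irr : irreflexive e)
    (h_tough : tough e (1%R : R)) (h_conn : k_connected e k)
    (h_free : free_of (@P2_kP1 k) e) (h_alpha : alpha_e e <= k) :
  hamiltonian e.
Proof.
have [c [Cc c_gt2 c_max]] := exists_longest_cycle e_sym e_irr hk h_conn.
exists c; split=> // v; apply/negPn/negP => vc.
have c_gt0 : 0 < size c by apply: leq_trans c_gt2.
have kN := card_attachments e_sym Cc vc c_max c_gt0 h_conn.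
have vH := self_in_component e c v.
have Dc y : e v y -> y \in c.
  move=> vy; apply/negPn/negP => yc.
  have yH : y \in component e (~: [set z in c]) v.
    by apply: component_closed vH _ vy; rewrite !inE.
  exact: (component_edge_P2_kP1 e_sym e_irr Cc vc c_max kN vH yH vy) h_free.
have := successors_essential e_sym e_irr Cc vc c_max Dc.
by rewrite ltnNge (leq_trans h_alpha (degree_ge v e_irr h_conn)).
Qed.
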